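(* Let $\mathbb{K}$ be a field of characteristic $0$, and let $$\sum_{i=0}^{k}P_i(x)f^{(i)}(x)=0$$ be a differential equation with coefficients $P_i\in\mathbb{K}[x]$ of order $k>0$ (so $P_k\ne 0$). Consider a family $F=\{(x-a_i)^{e_i} : 1\le i\le s\}$ with $a_i\in\mathbb{K}$, $e_i\in\mathbb{N}$, $e_i\ge k$ for all $i$, and the pairs $(a_i,e_i)$ pairwise distinct, such that the equation is satisfied simultaneously by all the elements of $F$. Then $\prod_{i=1}^{s}(x-a_i)$ divides $P_k$.
   Context: $f^{(i)}$ denotes the $i$-th derivative of the polynomial $f$. The $a_i$ themselves need not be distinct. *)

(* Defs.v *)
From HB Require Import structures.
From mathcomp Require Import all_boot all_order all_algebra.

Set Implicit Arguments.
Unset Strict Implicit.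
Unset Printing Implicit Defensive.

Import GRing.Theory.
Local Open Scope ring_scope.

Definition poly_ode_sol (K : fieldType) (k : nat)
    (P : 'I_k.+1 -> {poly K}) (f : {poly K}) : Prop :=
  \sum_(i < k.+1) P i * f^`(i) = 0.

(* Main.v *)
Require Import Defs.
From HB Require Import structures.
From mathcomp Require Import all_boot all_order all_algebra.
From mathcomp Require Import zify.

Set Implicit Arguments.
Unset Strict Implicit.
Unset Printing Implicit Defensive.

Import GRing.Theory.
Local Open Scope ring_scope.

(** Fix a point c and let m be the number of indices i with a_i = c; the
    corresponding exponents are m distinct integers e >= k. After the change of
    variable x -> x + c, with G_i(x) = P_i(x + c), each of them satisfies
    sum_i G_i * x^(e-i) * e^_i = 0, where e^_i is the falling factorial. Reading
    off the coefficient of x^(e-k+v) gives, for every v,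
      sum_i b_i * e^_i = 0,   b_i = coefficient of x^(v+i-k) in G_i,
    with b_i = 0 when v + i < k. The b_i do not depend on e, so the polynomial
    r(t) = sum_i b_i * t^_i, of degree at most k, vanishes at the m exponents.
    As b_i = 0 for i < k - v, it also vanishes at 0, ..., k - v - 1, which
    differ from the exponents because these are at least k. If v < m this makes
    more than k distinct roots in characteristic 0, so r = 0 and its leading
    coefficient b_k = [x^v] G_k vanishes ([ffact_comb_lead_eq0]). Hence x^m
    divides G_k, that is, (x - c)^m divides P_k
    ([XsubC_exp_dvdp_lead_coef_ode]). These local multiplicities combine into
    divisibility by the whole product because linear factors at distinct points
    are coprime ([prod_XsubC_dvdp_mup]). *)

Definition ffact_poly (R : comNzRingType) (i : nat) : {poly R} :=
  \prod_(j <- iota 0 i) ('X - j%:R%:P).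

Lemma size_ffact_poly (R : comNzRingType) i : size (ffact_poly R i) = i.+1.
Proof. by rewrite size_prod_XsubC size_iota. Qed.

Lemma horner_ffact_poly (R : comNzRingType) i n :
  (ffact_poly R i).[n%:R] = (n ^_ i)%:R.
Proof.
rewrite /ffact_poly horner_prod; elim: i => [|i IHi]; first by rewrite big_nil.
rewrite -addn1 iotaD big_cat big_seq1 /= IHi add0n hornerXsubC addn1 ffactnSr.
have [le_in | lt_ni] := leqP i n; first by rewrite natrM natrB.
(* Truncated subtraction is harmless here, as n^_i is already 0. *)
by rewrite ffact_small // mul0r mul0n.
Qed.

(** The combination is the value at n of a polynomial of degree at most k whose
    coefficient in degree k is [b ord_max]; in characteristic 0 the integers in
    [r] are distinct in K, too many to be roots of a nonzero such polynomial. *)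
Lemma ffact_comb_lead_eq0 (K : fieldType) (charK0 : [pchar K] =i pred0)
    (k : nat) (b : 'I_k.+1 -> K) (r : seq nat) :
    uniq r -> (k < size r)%N ->
    {in r, forall n, \sum_(i < k.+1) b i *+ n ^_ i = 0} ->
  b ord_max = 0.
Proof.
move=> r_uniq lt_kr r_root.
pose p : {poly K} := \sum_(i < k.+1) b i *: ffact_poly K i.
have natK_inj : injective (fun n : nat => n%:R : K).
  have /pcharf0P natK_eq0 := charK0.
  move=> m n /= eq_mn; wlog le_mn : m n eq_mn / (m <= n)%N.
    by move=> IH; case: (leqP m n) => [|/ltnW] /IH => [->|<-].
  apply/eqP; rewrite eqn_leq le_mn -subn_eq0 -natK_eq0 natrB //.
  by rewrite eq_mn subrr eqxx.
have size_p : (size p <= k.+1)%N.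
  apply/(leq_trans (size_sum _ _ _))/bigmax_leqP => i _.
  by rewrite (leq_trans (size_scale_leq _ _)) // size_ffact_poly.
have p0 : p = 0.
  apply: contraTeq lt_kr => p_neq0; rewrite -leqNgt -ltnS.
  apply: leq_trans size_p; rewrite -(size_map (fun n : nat => n%:R : K)).
  apply: max_poly_roots; rewrite ?map_inj_uniq // all_map.
  apply/allP => n r_n /=; rewrite /root -[X in _ == X](r_root n r_n) horner_sum.
  apply/eqP/eq_bigr => i _; rewrite hornerZ horner_ffact_poly mulr_natr //.
have := coef0 K k; rewrite -{1}p0 coef_sum big_ord_recr /= big1 => [|i _].
  have /monicP : ffact_poly K k \is monic by apply: monic_prod_XsubC.
  by rewrite lead_coefE size_ffact_poly add0r coefZ => ->; rewrite mulr1.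
by rewrite coefZ nth_default ?mulr0 // size_ffact_poly /=.
Qed.

Lemma derivn_XsubC_exp (R : comNzRingType) (c : R) e i :
  (('X - c%:P) ^+ e)^`(i) = ('X - c%:P) ^+ (e - i) *+ e ^_ i.
Proof.
elim: i => [|i IHi]; first by rewrite subn0 ffactn0.
rewrite derivnS IHi derivMn deriv_exp derivXsubC mul1r.
by rewrite -mulrnA ffactnSr mulnC subnS.
Qed.

(** The local statement at one point c. Translating c to 0 turns the equation
    into relations between the coefficients of the translated [P i], to which
    [ffact_comb_lead_eq0] applies once for each v < [size E]; this shows that
    the translate of [P ord_max] has no term of degree less than [size E]. *)
Lemma XsubC_exp_dvdp_lead_coef_ode (K : fieldType)
    (charK0 : [pchar K] =i pred0) (k : nat) (P : 'I_k.+1 -> {poly K})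
    (c : K) (E : seq nat) :
    uniq E -> {in E, forall n, (k <= n)%N} ->
    {in E, forall n, poly_ode_sol P (('X - c%:P) ^+ n)} ->
  ('X - c%:P) ^+ size E %| P ord_max.
Proof.
move=> E_uniq E_ge_k E_sol.
pose G i := P i \Po ('X + c%:P).
have G_eq n : n \in E -> \sum_(i < k.+1) G i * 'X^(n - i) *+ n ^_ i = 0.
  move=> /E_sol /(congr1 (comp_poly ('X + c%:P))).
  rewrite comp_poly0 raddf_sum => sol_n; rewrite -[RHS]sol_n.
  apply: eq_bigr => i _; rewrite derivn_XsubC_exp mulrnAr raddfMn /=.
  by rewrite comp_polyM rmorphXn /= comp_polyB comp_polyX comp_polyC addrK.
have Gk_coef v : (v < size E)%N -> (G ord_max)`_v = 0.
  move=> lt_vE.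
  pose b (i : 'I_k.+1) := if (v + i < k)%N then 0 else (G i)`_(v + i - k).
  have -> : (G ord_max)`_v = b ord_max.
    by rewrite /b /= addnK ltnNge leq_addl.
  (* The k - v integers below k - v bring the roots to more than k; if k <= v
     there are none of them, but then E alone has more than k elements. *)
  apply: (ffact_comb_lead_eq0 charK0 (r := iota 0 (k - v) ++ E)).
  - rewrite cat_uniq iota_uniq E_uniq andbT; apply/hasPn => n /E_ge_k le_kn.
    by rewrite mem_iota /= add0n -leqNgt (leq_trans (leq_subr _ _)).
  - rewrite size_cat size_iota; have [le_vk | lt_kv] := leqP v k.
      by rewrite -{1}(subnK le_vk) ltn_add2l.
    by rewrite (leq_trans lt_kv) // (leq_trans (ltnW lt_vE)) // leq_addl.
  move=> n; rewrite mem_cat mem_iota /= add0n => /orP[lt_n_kv | E_n].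
    (* Here either b_i or n^_i vanishes, according to the sign of n - i. *)
    apply: big1 => i _; rewrite /b; have [le_in | lt_ni] := leqP i n.
      have -> : (v + i < k)%N by lia.
      by rewrite mul0rn.
    by rewrite ffact_small.
  (* In degree v + (n - k), the index v + i - k of the coefficient taken from
     [G i] no longer depends on n. *)
  have := congr1 (fun q : {poly K} => q`_(v + (n - k))) (G_eq n E_n).
  rewrite /= coef0 coef_sum => sum0; rewrite -[RHS]sum0.
  apply: eq_bigr => i _; rewrite coefMn coefMXn /b.
  have le_kn := E_ge_k n E_n; have le_ik : (i <= k)%N by rewrite -ltnS.
  have le_in := leq_trans le_ik le_kn.
  have -> : (v + (n - k) < n - i)%N = (v + i < k)%N by lia.
  case: ifP => // /negbT; rewrite -leqNgt => le_kvi.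
  by congr (_`_ _ *+ _); lia.
have dvd_G : 'X^(size E) %| G ord_max.
  rewrite -(poly_take_drop (size E) (G ord_max)).
  suff -> : take_poly (size E) (G ord_max) = 0 by rewrite add0r dvdp_mull.
  apply/polyP => v; rewrite coef_take_poly coef0.
  by case: ifP => // /Gk_coef.
have := dvdp_comp_poly ('X - c%:P) dvd_G.
rewrite comp_Xn_poly /G -comp_polyA comp_polyD comp_polyX comp_polyC subrK.
by rewrite comp_polyXr.
Qed.

(** Removing one factor from the product lowers both the count and the
    multiplicity at its point by one, and changes nothing elsewhere. *)
Lemma prod_XsubC_dvdp_mup (K : fieldType) (r : seq K) (q : {poly K}) :
    q != 0 -> (forall c, (count_mem c r <= mup c q)%N) ->
  \prod_(y <- r) ('X - y%:P) %| q.
Proof.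
elim: r q => [|y r IHr] q q_neq0 le_mup; first by rewrite big_nil dvd1p.
have : 'X - y%:P %| q.
  by rewrite XsubC_dvd // (leq_trans _ (le_mup y)) //= eqxx.
case/dvdpP => u def_q; rewrite def_q big_cons mulrC dvdp_mul //.
move: q_neq0; rewrite def_q mulf_eq0 negb_or => /andP[u_neq0 Xy_neq0].
apply: IHr => // c; have := le_mup c.
rewrite def_q mupM // -['X - _]expr1 mup_XsubCX /= addnC.
by case: (y == c); rewrite ?leq_add2r // addn0.
Qed.

Theorem corollary2p5 (K : fieldType) (charK0 : [pchar K] =i pred0)
    (k : nat) (k_gt0 : (0 < k)%N)
    (P : 'I_k.+1 -> {poly K}) (Pk_neq0 : P ord_max != 0)
    (s : nat) (a : 'I_s -> K) (e : 'I_s -> nat)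
    (e_ge_k : forall i : 'I_s, (k <= e i)%N)
    (ae_distinct : injective (fun i : 'I_s => (a i, e i)))
    (F_sol : forall i : 'I_s, poly_ode_sol P (('X - (a i)%:P) ^+ e i)) :
  \prod_(i < s) ('X - (a i)%:P) %| P ord_max.
Proof.
rewrite -(big_map a predT (fun y => 'X - y%:P)).
apply: prod_XsubC_dvdp_mup => // c; rewrite mup_geq //.
pose E := [seq e i | i <- index_enum 'I_s & a i == c].
have -> : count_mem c [seq a i | i <- index_enum 'I_s] = size E.
  by rewrite size_map size_filter count_map.
apply: XsubC_exp_dvdp_lead_coef_ode => //.
- rewrite map_inj_in_uniq ?filter_uniq ?index_enum_uniq // => i j.
  rewrite !mem_filter => /andP[/eqP ai _] /andP[/eqP aj _] eq_e.
  by apply: ae_distinct; rewrite ai aj eq_e.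
- by move=> n /mapP[i _ ->].
- move=> n /mapP[i]; rewrite mem_filter => /andP[/eqP <- _] ->; exact: F_sol.
Qed.
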